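(* Let $\mathcal{L}$ be a geometric lattice with grading $r$, and let $\mathcal{K}$ be a geometric modular lattice with maximum element $1_\mathcal{K}$, endowed with a non-decreasing modular function $\rho:\mathcal{K}\to\mathbb{Z}_{\geq 0}$ (not necessarily its grading). Suppose $r$ is pseudomodular on a sublattice $\mathcal{L}'$ of $\mathcal{L}$, and $\phi:\mathcal{K}\to\mathcal{L}'$ satisfies: (i) $\phi(X\wedge Y)=\phi(X)\wedge\phi(Y)$ for all $X,Y\in\mathcal{K}$; (ii) $\phi(X\vee Y)=\phi(X)\vee\phi(Y)$ whenever $X,Y\in\mathcal{K}$ and $X\vee Y=1_\mathcal{K}$; (iii) $\rho(Y)=r(\phi(Y))$ whenever $Y\in\mathcal{K}$ and the interval $[Y,1_\mathcal{K}]$ has length at most $2$. Then (a) $\phi$ is a lattice homomorphism satisfying $\rho(X)=r(\phi(X))$ for all $X\in\mathcal{K}$, and (b) $\phi(\mathcal{K})$ is a modular sublattice of $\mathcal{L}$.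
   Context: A graded lattice (with minimum $0$) has a grading $r:\mathcal{L}\to\mathbb{Z}_{\geq0}$ with $r(0)=0$, $x<y\Rightarrow r(x)<r(y)$, and $r(y)=r(x)+1$ whenever $y$ covers $x$. It is atomistic if every nonzero element is a join of finitely many atoms (elements of grade 1), semimodular if $r(x)+r(y)\geq r(x\vee y)+r(x\wedge y)$ for all $x,y$, and geometric if graded, atomistic and semimodular. A function $f$ on a lattice is modular if $f(x)+f(y)=f(x\vee y)+f(x\wedge y)$ for all $x,y$; a lattice is modular if its grading is modular. A sublattice is a nonempty subset closed under $\wedge$ and $\vee$. A function $r$ is pseudomodular on a sublattice $\mathcal{L}'$ if for all $X,Y,Z\in\mathcal{L}'$ with $r(X\vee Z)-r(X)=r(Y\vee Z)-r(Y)=r(X\vee Y\vee Z)-r(X\vee Y)$ one has $r((X\vee Z)\wedge(Y\vee Z))-r(X\wedge Y)=r(X\vee Z)-r(X)$. A lattice homomorphism preserves $\wedge$ and $\vee$. *)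

(* Defs.v *)
From HB Require Import structures.
From mathcomp Require Import all_boot all_order all_algebra.
From mathcomp Require Import boolp classical_sets.
Set Implicit Arguments.
Unset Strict Implicit.
Unset Printing Implicit Defensive.
Import Order.TTheory GRing.Theory.
Open Scope order_scope.

Section Sublattices.
Context {d : Order.disp_t} {T : latticeType d}.
Implicit Types (S : set T) (x y z m : T) (s : seq T).

Definition sublattice S : Prop :=
  [/\ nonempty S,
      forall x y, S x -> S y -> S (x `&` y)
    & forall x y, S x -> S y -> S (x `|` y)].

Definition covers_in S x y : Prop :=
  [/\ S x, S y, x < y & forall z, S z -> ~~ (x < z < y)].

(* [g] grades the poset [S] (with the order of [T]) whose minimum is [m];
   the values of [g] outside [S] are irrelevant. *)
Definition grading_on S m (g : T -> nat) : Prop :=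
  [/\ S m /\ (forall x, S x -> m <= x),
      g m = 0%N,
      forall x y, S x -> S y -> x < y -> (g x < g y)%N
    & forall x y, covers_in S x y -> g y = (g x).+1].

Definition modular_on S (f : T -> nat) : Prop :=
  forall x y, S x -> S y -> (f x + f y = f (x `|` y) + f (x `&` y))%N.

Definition pseudomodular_on S (r : T -> nat) : Prop :=
  forall X Y Z, S X -> S Y -> S Z ->
    ((r (X `|` Z))%:Z - (r X)%:Z = (r (Y `|` Z))%:Z - (r Y)%:Z)%R ->
    ((r (Y `|` Z))%:Z - (r Y)%:Z
       = (r (X `|` Y `|` Z))%:Z - (r (X `|` Y))%:Z)%R ->
    ((r ((X `|` Z) `&` (Y `|` Z)))%:Z - (r (X `&` Y))%:Z
       = (r (X `|` Z))%:Z - (r X)%:Z)%R.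

(* The modularity asked for is that of the intrinsic grading of [S], which in
   general is not the restriction of a grading of [T]. *)
Definition modular_sublattice S : Prop :=
  sublattice S /\ exists m g, grading_on S m g /\ modular_on S g.

(* A chain with k + 1 elements has length k. *)
Definition interval_length_le x y (n : nat) : Prop :=
  forall s, sorted <%O s -> all (fun z => x <= z <= y) s -> (size s <= n.+1)%N.

End Sublattices.

Section Geometric.
Context {d : Order.disp_t} {T : bLatticeType d}.
Implicit Types (r : T -> nat) (x y : T).

Definition is_grading r : Prop := grading_on setT \bot r.

Definition atomistic r : Prop :=
  forall x, x != \bot ->
    exists s : seq T, all (fun a => r a == 1%N) s /\ x = \join_(a <- s) a.

Definition semimodular r : Prop :=
  forall x y, (r (x `|` y) + r (x `&` y) <= r x + r y)%N.

Definition geometric r : Prop := [/\ is_grading r, atomistic r & semimodular r].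

End Geometric.

(* Main.v *)
Require Import Defs.
From HB Require Import structures.
From mathcomp Require Import all_boot all_order all_algebra.
From mathcomp Require Import boolp classical_sets.
From mathcomp Require Import zify.
Import Order.TTheory GRing.Theory.
Open Scope order_scope.

(** The rank identity [rho X = r (phi X)] is proved by induction on the corank
    of [X].  If it is known on [Y, \top], let [C] be a complement of [X `|` Y]
    in [Y, \top]; then [C `|` X = \top], so [phi C `|` phi X = phi \top], and
    submodularity of [r] on [phi X `|` phi Y] and [phi C] bounds
    [r (phi X `|` phi Y)] from below by [rho (X `|` Y)]: joins with [Y] are
    preserved.  When [X] has corank at least 3, pick three independent atoms
    [A], [B], [Z] of [X, \top]; joins between them are preserved, so
    pseudomodularity applies to their images, and as
    [(A `|` Z) `&` (B `|` Z) = Z] and [A `&` B = X] it gives the identity at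
    [X].

    For the modularity of the image, let [e] be the greatest element with
    [phi e = phi \bot].  Complements in [K] show that [X `|` e] is the greatest
    element with the same image as [X], so the image of [phi] is isomorphic to
    the interval [e, \top] of [K], graded by [rK (X `|` e) - rK e]. *)

(** * Monotonicity of gradings *)

Lemma grading_lt {d : Order.disp_t} {T : bLatticeType d} {r : T -> nat} :
  is_grading r -> forall x y, x < y -> (r x < r y)%N.
Proof. by case=> _ _ rlt _ x y; apply: rlt. Qed.

Lemma grading_le {d : Order.disp_t} {T : bLatticeType d} {r : T -> nat} :
  is_grading r -> forall x y, x <= y -> (r x <= r y)%N.
Proof.
move=> gr x y; rewrite le_eqVlt => /orP[/eqP->//|/(grading_lt gr)].
exact: ltnW.
Qed.

Lemma le_grading_eq {d : Order.disp_t} {T : bLatticeType d} {r : T -> nat} :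
  is_grading r -> forall x y, x <= y -> (r y <= r x)%N -> x = y.
Proof.
move=> gr x y; rewrite le_eqVlt => /orP[/eqP->//|/(grading_lt gr)].
by rewrite ltnNge => /negPf->.
Qed.

(** * Atoms and complements in a geometric modular lattice *)

Section GeometricModular.
Context {d : Order.disp_t} {T : tbLatticeType d} {rk : T -> nat}.
Context (rk_geometric : geometric rk) (rk_modular : modular_on setT rk).
Implicit Types (a x y z u w : T).

Let rk_grading : is_grading rk. Proof. by case: rk_geometric. Qed.
Let rk_le1 x : (rk x <= rk \top)%N.
Proof. exact/(grading_le rk_grading)/lex1. Qed.
Let rk_mod x y : (rk x + rk y = rk (x `|` y) + rk (x `&` y))%N.
Proof. exact: rk_modular. Qed.

Lemma size_sorted_lt (s : seq T) x :
  path <%O x s -> (size s + rk x <= rk \top)%N.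
Proof.
elim: s x => [|y s IHs] x /=; first by move=> _; exact: rk_le1.
by case/andP => /(grading_lt rk_grading) xy /IHs; lia.
Qed.

Lemma interval_length_le_corank x n :
  (rk \top <= rk x + n)%N -> interval_length_le x \top n.
Proof.
move=> xn [//|y s] /= /size_sorted_lt ys /andP[/andP[xy _] _].
by have := grading_le rk_grading _ _ xy; lia.
Qed.

Lemma exists_atom x y : ~~ (y <= x) ->
  exists a, [/\ rk a = 1%N, a <= y & ~~ (a <= x)].
Proof.
move=> yx; have y0 : y != \bot by apply: contraNneq yx => ->; exact: le0x.
case: rk_geometric => _ /(_ y y0) [s [/allP s1 ys]] _.
have [/allP sx|/allPn[a sa ax]] := boolP (all (<= x) s).
  by case/negP: yx; rewrite ys big_seq; apply: joins_le => a; exact: sx.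
exists a; split=> //; first exact/eqP/s1.
by rewrite ys; apply: joins_sup_seq.
Qed.

Lemma rank_join_atom x a :
  rk a = 1%N -> ~~ (a <= x) -> rk (x `|` a) = (rk x).+1.
Proof.
move=> a1 ax; have := rk_mod x a.
have /(grading_lt rk_grading) : x `&` a < a.
  by rewrite lt_neqAle leIr andbT; apply: contraNneq ax => <-; exact: leIl.
lia.
Qed.

(** The meet lies strictly below [x]|[a], since [a] is not below [u], and [x]|[a] has rank only one
    more than [x]. *)
Lemma meet_join_atom x u a :
  rk a = 1%N -> x <= u -> ~~ (a <= u) -> (x `|` a) `&` u = x.
Proof.
move=> a1 xu au; apply/esym/(le_grading_eq rk_grading).
  by rewrite lexI leUl.
have ax : ~~ (a <= x) by apply: contra au => /le_trans; apply.
have /(grading_lt rk_grading) : (x `|` a) `&` u < x `|` a.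
  rewrite lt_neqAle leIl andbT; apply: contraNneq au => /meet_idPl.
  by rewrite leUx => /andP[].
by rewrite rank_join_atom.
Qed.

(** Induction on the corank of [w]: the same atom [a] is added to [y] and to [w]. A complement [c]
    for the enlarged pair also works for the original one, because [c]&[w = (y]|[a)]&[w = y]. *)
Lemma exists_complement_above y w : y <= w ->
  exists c, [/\ y <= c, c `&` w = y & c `|` w = \top].
Proof.
have [n] := ubnP (rk \top - rk w); elim: n y w => // n IHn y w ltn yw.
have [w1|w1] := boolP (\top <= w).
  move: w1; rewrite le1x => /eqP w1; exists y; split=> //.
    exact/meet_idPl.
  by rewrite w1 joinx1.
have [a [a1 _ aw]] := exists_atom _ _ w1.
have rwa := rank_join_atom _ _ a1 aw.
have wa1 := rk_le1 (w `|` a).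
case: (IHn (y `|` a) (w `|` a)) => [||c]; [by lia | exact: leU2 |].
rewrite leUx => -[/andP[yc ac] cw cw1]; exists c; split=> //.
  by rewrite -(meet_idPr (leUl w a)) meetA cw meet_join_atom.
by rewrite -cw1 [RHS]joinCA (join_idPl ac) joinC.
Qed.

Lemma exists_independent_atoms x : (rk x + 3 <= rk \top)%N ->
  exists a b z, [/\ [/\ rk a = (rk x).+1, rk b = (rk x).+1 & rk z = (rk x).+1],
    [/\ a `&` b = x, a `&` z = x, b `&` z = x & (a `|` b) `&` z = x]
    & (a `|` z) `&` (b `|` z) = z].
Proof.
have nle u : (rk u < rk \top)%N -> ~~ (\top <= u).
  by rewrite ltnNge; apply: contra => /(grading_le rk_grading).
move=> xn.
have [|a [a1 _ ax]] := exists_atom x \top; first by apply: nle; lia.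
have ra := rank_join_atom _ _ a1 ax.
have [|b [b1 _ bxa]] := exists_atom (x `|` a) \top; first by apply: nle; lia.
have rab := rank_join_atom _ _ b1 bxa.
have [|z [z1 _ zxab]] := exists_atom (x `|` a `|` b) \top.
  by apply: nle; lia.
have rabz := rank_join_atom _ _ z1 zxab.
have xab_eq : x `|` a `|` (x `|` b) = x `|` a `|` b.
  by rewrite joinACA joinxx joinA.
have le_b : x `|` b <= x `|` a `|` b by rewrite -xab_eq leUr.
have bx : ~~ (b <= x) by apply: contra bxa => /le_trans; apply; exact: leUl.
have zxa : ~~ (z <= x `|` a).
  by apply: contra zxab => /le_trans; apply; exact: leUl.
have zxb : ~~ (z <= x `|` b) by apply: contra zxab => /le_trans; apply.
have zx : ~~ (z <= x) by apply: contra zxa => /le_trans; apply; exact: leUl.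
have rb := rank_join_atom _ _ b1 bx.
have rz := rank_join_atom _ _ z1 zx.
have raz := rank_join_atom _ _ z1 zxa.
have rbz := rank_join_atom _ _ z1 zxb.
have joinxz u : x <= u -> u `|` (x `|` z) = u `|` z.
  by move=> xu; rewrite joinA (join_idPl xu).
exists (x `|` a), (x `|` b), (x `|` z); split=> //.
  rewrite xab_eq; split; rewrite meetC meet_join_atom // ?leUl //.
  by rewrite -joinA leUl.
(* Two elements of rank [rk x + 2] have a join of rank [rk x + 3], so by modularity their meet has
   rank [rk x + 1], the rank of [x]|[z]. *)
apply/esym/(le_grading_eq rk_grading); first by rewrite lexI !leUr.
have := rk_mod (x `|` a `|` (x `|` z)) (x `|` b `|` (x `|` z)).
rewrite !joinxz ?leUl //.
have -> : x `|` a `|` z `|` (x `|` b `|` z) = x `|` a `|` b `|` z.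
  by rewrite joinACA joinxx xab_eq.
move=> modE; rewrite -(leq_add2l (rk (x `|` a `|` b `|` z))) -modE.
by lia.
Qed.

End GeometricModular.

(** * Preservation of joins and ranks *)

Section RankPreserved.
Context {dL dK : Order.disp_t} {L : bLatticeType dL} {K : tbLatticeType dK}.
Context {r : L -> nat} {rK rho : K -> nat} {L' : set L} {phi : K -> L}.
Context (L_geometric : geometric r).
Context (K_geometric : geometric rK) (K_modular : modular_on setT rK).
Context (rho_modular : modular_on setT rho).
Context (phi_meet : forall X Y : K, phi (X `&` Y) = phi X `&` phi Y).
Context (phi_join : forall X Y : K,
  X `|` Y = \top -> phi (X `|` Y) = phi X `|` phi Y).

Let r_grading : is_grading r. Proof. by case: L_geometric. Qed.
Let r_semimod x y : (r (x `|` y) + r (x `&` y) <= r x + r y)%N.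
Proof. by case: L_geometric. Qed.
Let rK_grading : is_grading rK. Proof. by case: K_geometric. Qed.
Let rho_mod X Y : (rho X + rho Y = rho (X `|` Y) + rho (X `&` Y))%N.
Proof. exact: rho_modular. Qed.

Lemma meet_morphism_le (X Y : K) : X <= Y -> phi X <= phi Y.
Proof. by move/meet_idPl => <-; rewrite phi_meet leIr. Qed.

Lemma join_preserved (X Y : K) :
    (forall V, Y <= V -> rho V = r (phi V)) ->
  phi (X `|` Y) = phi X `|` phi Y.
Proof.
move=> rhoE; apply/esym/(le_grading_eq r_grading).
  by rewrite leUx !meet_morphism_le ?leUl ?leUr.
have [C [YC CW CW1]] :=
  exists_complement_above K_geometric K_modular _ _ (leUr Y X).
have XC1 : X `|` C = \top by rewrite -CW1 [RHS]joinCA (join_idPl YC).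
have joinE : phi X `|` phi Y `|` phi C = phi (C `|` (X `|` Y)).
  rewrite joinAC -phi_join // XC1 CW1.
  exact/join_idPl/meet_morphism_le/lex1.
(* All four elements in this identity lie above [Y], so [rhoE] turns each [rho] into a rank in
   [L]. *)
have := rho_mod C (X `|` Y).
rewrite CW !rhoE ?leUr // ?(le_trans YC (leUl _ _)) //.
have := r_semimod (phi X `|` phi Y) (phi C); rewrite joinE.
have /(grading_le r_grading) : phi Y <= (phi X `|` phi Y) `&` phi C.
  by rewrite lexI leUr meet_morphism_le.
lia.
Qed.

Context (r_pseudomodular : pseudomodular_on L' r).
Context (phi_L' : forall X : K, L' (phi X)).
Context (phi_rho : forall Y : K,
  interval_length_le Y \top 2 -> rho Y = r (phi Y)).

Lemma rank_preserved (X : K) : rho X = r (phi X).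
Proof.
have [n] := ubnP (rK \top - rK X); elim: n X => // n IHn X ltn.
have [Xn|Xn] := leqP (rK X + 3) (rK \top); last first.
  by apply/phi_rho/(interval_length_le_corank K_geometric); lia.
have rhoE U V : rK U = (rK X).+1 -> U <= V -> rho V = r (phi V).
  by move=> rU /(grading_le rK_grading) UV; apply: IHn; lia.
have [A [B [Z [[rA rB rZ] [AB AZ BZ ABZ] ABZZ]]]] :=
  exists_independent_atoms K_geometric K_modular _ Xn.
have joinE U V : rK V = (rK X).+1 -> phi (U `|` V) = phi U `|` phi V.
  by move=> rV; apply: join_preserved => W; apply: rhoE.
have := r_pseudomodular _ _ _ (phi_L' A) (phi_L' B) (phi_L' Z).
rewrite -!joinE // -!phi_meet ABZZ AB.
rewrite -(rhoE Z (A `|` Z)) ?leUr // -(rhoE Z (B `|` Z)) ?leUr //.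
rewrite -(rhoE Z (A `|` B `|` Z)) ?leUr // -(rhoE B (A `|` B)) ?leUr //.
rewrite -(rhoE A A) // -(rhoE B B) // -(rhoE Z Z) //.
(* Modularity of [rho] makes all three differences in the pseudomodularity hypothesis equal to
   [rho Z - rho X]; the conclusion then reads [rho Z - r (phi X) = rho Z - rho X]. *)
have := rho_mod A Z; have := rho_mod B Z.
have := rho_mod (A `|` B) Z; rewrite AZ BZ ABZ.
lia.
Qed.

End RankPreserved.

(** * Modularity of the image *)

Section ImageModular.
Context {dL dK : Order.disp_t} {L : bLatticeType dL} {K : tbLatticeType dK}.
Context {rK : K -> nat} {phi : K -> L}.
Context (K_geometric : geometric rK) (K_modular : modular_on setT rK).
Context (phi_meet : Order.meet_morphism phi).
Context (phi_join : Order.join_morphism phi).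

Let rK_grading : is_grading rK. Proof. by case: K_geometric. Qed.
Let rK_mod X Y : (rK X + rK Y = rK (X `|` Y) + rK (X `&` Y))%N.
Proof. exact: K_modular. Qed.

(** Ranks are bounded by that of [\top], and the fibre of [phi \bot] is closed under joins, so a
    member of maximal rank is its greatest element. *)
Lemma exists_greatest_kernel :
  exists2 e, phi e = phi \bot & forall X, phi X = phi \bot -> X <= e.
Proof.
pose P n := `[< exists2 X, phi X = phi \bot & rK X = n >].
have exP : exists n, P n by exists (rK \bot); apply/asboolP; exists \bot.
have ubP n : P n -> (n <= rK \top)%N.
  by move/asboolP => [X _ <-]; apply/(grading_le rK_grading)/lex1.
case: (ex_maxnP exP ubP) => n /asboolP[e eE en] max_n.
exists e => // X XE.
have /max_n le_n : P (rK (e `|` X)).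
  by apply/asboolP; exists (e `|` X) => //; rewrite phi_join eE XE joinxx.
suff -> : e = e `|` X by exact: leUr.
by apply/(le_grading_eq rK_grading); rewrite ?leUl ?en.
Qed.

(** For a complement [C] of [X], the map sends [C]&[(X]|[Y)] to [phi C]&[phi X = phi \bot], so this
    element is below [e]; joined with [X] it gives back [X]|[Y]. *)
Lemma join_kernel_le e X Y : (forall V, phi V = phi \bot -> V <= e) ->
  phi X = phi Y -> Y <= X `|` e.
Proof.
move=> max_e XY.
have [C [_ CX CX1]] :=
  exists_complement_above K_geometric K_modular _ _ (le0x X).
have CYe : C `&` (X `|` Y) <= e.
  by apply: max_e; rewrite phi_meet phi_join -XY joinxx -phi_meet CX.
apply: (le_trans (leUr Y X)).
(* The modular law for [X <= X `|` Y], read off the ranks. *)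
have <- : X `|` (C `&` (X `|` Y)) = X `|` Y.
  apply/(le_grading_eq rK_grading); first by rewrite leUx leUl leIr.
  have := rK_mod C X; rewrite CX CX1.
  have := rK_mod C (X `|` Y); rewrite joinA CX1 join1x.
  have := rK_mod X (C `&` (X `|` Y)).
  rewrite meetCA (meet_idPl (leUl X Y)) CX; lia.
by rewrite leU2.
Qed.

Lemma modular_sublattice_range : modular_sublattice (range phi).
Proof.
split.
  split; first by exists (phi \bot), \bot.
    by move=> _ _ [X _ <-] [Y _ <-]; exists (X `&` Y).
  by move=> _ _ [X _ <-] [Y _ <-]; exists (X `|` Y).
have [e eE max_e] := exists_greatest_kernel.
have phi_e X : phi (X `|` e) = phi X.
  by rewrite phi_join eE -phi_join joinx0.
have join_eE X Y : phi X = phi Y -> X `|` e = Y `|` e.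
  by move=> XY; apply/le_anti; rewrite !leUx !leUr !join_kernel_le.
have join_e_meet X Y : (X `&` Y) `|` e = (X `|` e) `&` (Y `|` e).
  rewrite -[RHS](join_idPl (_ : e <= _)) ?lexI ?leUr //.
  by apply: join_eE; rewrite !phi_meet !phi_e.
have phi_lt X Y : (phi X < phi Y) = (X `|` e < Y `|` e).
  have phi_le : (phi X <= phi Y) = (X `|` e <= Y `|` e).
    apply/idP/idP => [/meet_idPl|/meet_idPl]; rewrite -?phi_meet => XY.
      by apply/meet_idPl; rewrite -join_e_meet; apply: join_eE.
    by apply/meet_idPl; rewrite -phi_meet -phi_e join_e_meet XY phi_e.
  rewrite !lt_neqAle phi_le; congr (~~ _ && _).
  by apply/eqP/eqP => [/join_eE //|XY]; rewrite -phi_e XY phi_e.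
(* [xget] picks an arbitrary preimage, with [\bot] as default outside the image; the choice is
   harmless, since by [join_eE] the join with [e] depends only on the image. *)
pose g y := (rK (xget \bot [set X | phi X = y] `|` e) - rK e)%N.
have gE X : (g (phi X) + rK e = rK (X `|` e))%N.
  rewrite subnK; last exact/(grading_le rK_grading)/leUr.
  congr rK; apply/join_eE.
  exact: (@xgetI _ _ [set V | phi V = phi X] X).
exists (phi \bot), g; split; last first.
  move=> _ _ [X _ <-] [Y _ <-]; rewrite -phi_join -phi_meet.
  apply: (@addIn (rK e + rK e)); rewrite [LHS]addnACA [RHS]addnACA !gE.
  by rewrite rK_mod -join_e_meet joinACA joinxx.
split.
- split; first by exists \bot.
  by move=> _ [X _ <-]; apply/meet_idPl; rewrite -phi_meet meet0x.
- by apply: (@addIn (rK e)); rewrite gE join0x.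
- move=> _ _ [X _ <-] [Y _ <-]; rewrite phi_lt.
  by move/(grading_lt rK_grading); rewrite -!gE ltn_add2r.
- move=> _ _ [[X _ <-] [Y _ <-] XY noZ].
  move: XY; rewrite phi_lt => XY.
  (* Adding one atom to [X]|[e] stays below [Y]|[e]; as nothing lies strictly between the images, it
     must reach [Y]|[e], so the rank rises by exactly one. *)
  have [a [a1 aY aX]] := exists_atom K_geometric _ _ (negbT (lt_geF XY)).
  have rZ := rank_join_atom K_geometric K_modular _ _ a1 aX.
  set Z := X `|` e `|` a in rZ.
  have eZ : Z `|` e = Z by apply/join_idPl; rewrite /Z joinAC leUr.
  have ZY : Z <= Y `|` e by rewrite leUx aY ltW.
  have : ~~ (phi X < phi Z < phi Y) by apply: noZ; exists Z.
  rewrite !phi_lt eZ lt_neqAle leUl andbT [Z < _]lt_neqAle ZY andbT.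
  rewrite negb_and !negbK => /orP[/eqP XZ|/eqP ZYe].
    by move: rZ; rewrite -XZ; lia.
  by apply: (@addIn (rK e)); rewrite addSn !gE -ZYe.
Qed.

End ImageModular.

Theorem mainTheorem7 (dL dK : Order.disp_t)
    (L : bLatticeType dL) (K : tbLatticeType dK)
    (r : L -> nat) (rK rho : K -> nat) (L' : set L) (phi : K -> L)
    (L_geometric : geometric r)
    (K_geometric : geometric rK) (K_modular : modular_on setT rK)
    (rho_nondecreasing : forall X Y : K, X <= Y -> (rho X <= rho Y)%N)
    (rho_modular : modular_on setT rho)
    (L'_sublattice : sublattice L') (r_pseudomodular : pseudomodular_on L' r)
    (phi_L' : forall X : K, L' (phi X))
    (phi_meet : forall X Y : K, phi (X `&` Y) = phi X `&` phi Y)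
    (phi_join : forall X Y : K,
      X `|` Y = \top -> phi (X `|` Y) = phi X `|` phi Y)
    (phi_rho : forall Y : K,
      interval_length_le Y \top 2 -> rho Y = r (phi Y)) :
  [/\ Order.meet_morphism phi, Order.join_morphism phi
    & forall X : K, rho X = r (phi X)]
  /\ modular_sublattice (range phi).
Proof.
have rankE : forall X, rho X = r (phi X).
  exact: (rank_preserved L_geometric K_geometric K_modular rho_modular
            phi_meet phi_join r_pseudomodular phi_L' phi_rho).
have joinE : Order.join_morphism phi.
  move=> X Y; apply: (join_preserved L_geometric K_geometric K_modular
    rho_modular phi_meet phi_join) => V _; exact: rankE.
split; first by split.
exact: (modular_sublattice_range K_geometric K_modular).
Qed.
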